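(* Up to automorphisms of $\mathbb{P}^2(\mathbb{C})$ there are exactly four quadratic foliations $\mathcal{F}_1,\dots,\mathcal{F}_4$ on $\mathbb{P}^2(\mathbb{C})$ having exactly one singular point (i.e. each of $\mathcal{F}_1,\dots,\mathcal{F}_4$ has a unique singular point, they are pairwise non-conjugate, and every quadratic foliation with a unique singular point is conjugate to one of them). They are described in the affine chart $Z=1$ respectively by the $1$-forms 1. $\omega_1=x^2\,\mathrm{d}x+y^2(x\,\mathrm{d}y-y\,\mathrm{d}x)$; 2. $\omega_2=x^2\,\mathrm{d}x+(x+y^2)(x\,\mathrm{d}y-y\,\mathrm{d}x)$; 3. $\omega_3=xy\,\mathrm{d}x+(x^2+y^2)(x\,\mathrm{d}y-y\,\mathrm{d}x)$; 4. $\omega_4=(x+y^2-x^2y)\,\mathrm{d}y+x(x+y^2)\,\mathrm{d}x$.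
   Context: A foliation $\mathcal{F}$ of degree $N$ on $\mathbb{P}^2(\mathbb{C})$ (homogeneous coordinates $(X:Y:Z)$) is given, up to a nonzero scalar, by a homogeneous $1$-form $\omega=a\,\mathrm{d}X+b\,\mathrm{d}Y+c\,\mathrm{d}Z$ on $\mathbb{C}^3$, where $a,b,c$ are homogeneous polynomials of degree $N+1$ without common factor satisfying $aX+bY+cZ=0$. Its singular points are the points of $\mathbb{P}^2(\mathbb{C})$ where $a=b=c=0$. Quadratic means of degree $2$. In the affine chart $Z=1$, with $x=X/Z$, $y=Y/Z$, the foliation is described by the restriction of $\omega$, a polynomial $1$-form in $x,y$. The group $\mathrm{Aut}(\mathbb{P}^2(\mathbb{C}))=\mathrm{PGL}_3(\mathbb{C})$ acts on foliations by pullback; two foliations are conjugate if they lie in the same orbit. *)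

(* Defs.v *)
From HB Require Import structures.
From mathcomp Require Import all_boot all_order all_algebra.
From mathcomp Require Import mpoly complex reals.

Set Implicit Arguments.
Unset Strict Implicit.
Unset Printing Implicit Defensive.

Import GRing.Theory.
Local Open Scope ring_scope.

(* The 1-form \sum_i w 0 i dX_i with polynomial coefficients on K^n. *)
Definition poly_form (K : fieldType) (n : nat) := 'rV[{mpoly K[n]}]_n.

Definition poly_differential (K : fieldType) (n : nat) (f : {mpoly K[n]}) :
    poly_form K n :=
  \row_j f^`M(j).

(* Pullback of w by the polynomial map phi : K^m -> K^n. *)
Definition form_pullback (K : fieldType) (m n : nat)
    (phi : n.-tuple {mpoly K[m]}) (w : poly_form K n) : poly_form K m :=
  \sum_i (w 0 i \mPo phi) *: poly_differential (tnth phi i).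

(* Every common divisor is a nonzero constant; in particular w != 0. *)
Definition no_common_factor (K : fieldType) (n : nat) (w : poly_form K n) :
    Prop :=
  forall d : {mpoly K[n]},
    (forall i, exists q, w 0 i = d * q) -> d \is a GRing.unit.

(* The zero polynomial satisfies .-homog, as it should here: a single
   coefficient of w may vanish. *)
Definition is_foliation (K : fieldType) (N : nat) (w : poly_form K 3) : Prop :=
  [/\ forall i, w 0 i \is N.+1.-homog,
      no_common_factor w
    & \sum_i w 0 i * 'X_i = 0].

(* Forms define the same foliation when they agree up to a nonzero scalar. *)
Definition same_foliation (K : fieldType) (w w' : poly_form K 3) : Prop :=
  exists2 k : K, k != 0 & w' = k%:MP *: w.

(* Points of P^2(K) are given by homogeneous coordinates. *)
Definition same_point (K : fieldType) (p q : 'rV[K]_3) : Prop :=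
  exists2 k : K, k != 0 & q = k *: p.

Definition singular_point (K : fieldType) (w : poly_form K 3) (p : 'rV[K]_3) :
    Prop :=
  p != 0 /\ forall i, (w 0 i).@[p 0] = 0.

Definition has_unique_singular_point (K : fieldType) (w : poly_form K 3) :
    Prop :=
  exists2 p, singular_point w p
           & forall q, singular_point w q -> same_point p q.

(* The map v |-> A v on column vectors. *)
Definition linear_subst (K : fieldType) (n : nat) (A : 'M[K]_n) :
    n.-tuple {mpoly K[n]} :=
  [tuple \sum_j A i j *: 'X_j | i < n].

(* Elements of PGL_3(K) are represented by invertible matrices; a scalar
   matrix only multiplies a homogeneous form by a nonzero scalar. *)
Definition conjugate_foliations (K : fieldType) (w w' : poly_form K 3) :
    Prop :=
  exists2 A : 'M[K]_3,
    A \in unitmx & same_foliation w (form_pullback (linear_subst A) w').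

(* Restriction to the chart Z = 1, i.e. pullback by (x, y) |-> (x, y, 1). *)
Definition affine_restriction (K : fieldType) (w : poly_form K 3) :
    poly_form K 2 :=
  form_pullback [tuple 'X_0; 'X_1; 1] w.

Section AffineForms.

Variable K : fieldType.

Let x : {mpoly K[2]} := 'X_0.
Let y : {mpoly K[2]} := 'X_1.
Let dx : poly_form K 2 := poly_differential x.
Let dy : poly_form K 2 := poly_differential y.

Definition omega1 : poly_form K 2 :=
  x ^+ 2 *: dx + y ^+ 2 *: (x *: dy - y *: dx).

Definition omega2 : poly_form K 2 :=
  x ^+ 2 *: dx + (x + y ^+ 2) *: (x *: dy - y *: dx).

Definition omega3 : poly_form K 2 :=
  (x * y) *: dx + (x ^+ 2 + y ^+ 2) *: (x *: dy - y *: dx).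

Definition omega4 : poly_form K 2 :=
  (x + y ^+ 2 - x ^+ 2 * y) *: dy + (x * (x + y ^+ 2)) *: dx.

End AffineForms.

(* Main.v *)
Require Import Defs.
From HB Require Import structures.
From mathcomp Require Import all_boot all_order all_algebra.
From mathcomp Require Import mpoly complex reals.
From mathcomp Require Import boolp ring.

Set Implicit Arguments.
Unset Strict Implicit.
Unset Printing Implicit Defensive.

Import GRing.Theory.
Local Open Scope ring_scope.

(** Move the singular point to the vertex (0 : 0 : 1).  The relation
    aX + bY + cZ = 0 then forces the shape
<<
      a = - (Q1 Z^2 + Q2 Z + Y h),   b = P1 Z^2 + P2 Z + X h,
      c = Z (X Q1 - Y P1) + (X Q2 - Y P2),
>>
    where P1, Q1 are linear forms and P2, Q2, h quadratic forms in X, Y: in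
    the chart Z = 1 this is P dy - Q dx with P = P1 + P2 + x h and
    Q = Q1 + Q2 + y h.  Such data form a germ ([germ_of_foliation]).

    Every singular point lies on the cubic c = Z polar2 + polar3 = 0, which is
    singular at the vertex, hence parametrized by the lines (x : y) through
    the vertex.  Substituting the parametrization into a and b leaves a single
    binary sextic R = polar3 (P1 Q2 - Q1 P2) + h polar2^2: a zero of R at
    which polar2 does not vanish is a second singular point ([polar_res_neq0]).
    When polar2 and polar3 vanish together, the cubic contains the whole line,
    and the absence of another singular point on it forces P1, Q1, P2, Q2 to
    vanish in that direction, but not h ([polar_line]).

    Over an algebraically closed field these two facts determine everything.
    A form in one variable without zeros is constant, so that many
    coefficients vanish.  After a linear change of X and Y, polar2 either
    vanishes at (0 : 1) and nowhere else, which is impossible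
    ([single_tangent_absurd]), or vanishes at both (1 : 0) and (0 : 1), so
    that the linear part is diagonal.  If it is not scalar, exactly one
    eigenvalue is 0 and the coefficients of R give an orbit of one form, the
    fourth ([saddle_node_normal]).  If it is scalar, it is 0 and polar3 is a
    nonzero cubic binary form, at the zeros of which P2 and Q2 vanish; it has
    a triple zero (first and second form) or one double and one simple zero
    (third form) ([no_linear_part_normal]).

    A conjugacy between two of the four forms fixes the vertex, so that one
    coefficient of dZ becomes a multiple of the other after the substitution.
    These coefficients are - X^3, - X^3, - X^2 Y and - (X^3 + XYZ + Y^3); the
    coefficients of dY separate the first two forms
    ([normal_germs_not_conjugate]).

    Since an algebraically closed field is infinite, forms and their
    conjugacies are handled through the values of polynomials
    ([conjugate_valuesP]). *)

(** * Polynomials as functions *)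

Lemma poly_fun_eq0 (K : closedFieldType) (p : {poly K}) :
  (forall t, p.[t] = 0) -> p = 0.
Proof.
move=> p0; apply/eqP/negPn/negP => /closed_nonrootP[t].
by rewrite /root p0 eqxx.
Qed.

Lemma Poly_coef_eq0 (K : closedFieldType) (s : seq K) :
  (forall t, (Poly s).[t] = 0) -> forall i, s`_i = 0.
Proof. by move=> /poly_fun_eq0 s0 i; rewrite -coef_Poly s0 coef0. Qed.

(** Constants are the only polynomials without roots; all the equations between
    coefficients in the classification come from here. *)
Lemma Poly_rootless (K : closedFieldType) (s : seq K) :
  (forall t, (Poly s).[t] != 0) -> forall i, s`_i.+1 = 0.
Proof.
move=> s0 i; rewrite -coef_Poly; case: (altP (size (Poly s) =P 1%N)) => [s1|].
  by apply: nth_default; rewrite s1.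
by move=> /closed_rootP[t]; rewrite /root (negPf (s0 t)).
Qed.

Lemma digits_inj (N n : nat) (f g : nat -> nat) :
  (forall i, f i < N)%N -> (forall i, g i < N)%N ->
  (\sum_(i < n) f i * N ^ i = \sum_(i < n) g i * N ^ i)%N ->
  forall i, (i < n)%N -> f i = g i.
Proof.
elim: n f g => // n IHn f g ltf ltg.
have N_gt0 : (0 < N)%N by apply: leq_ltn_trans (ltf 0%N).
have digit0 (e : nat -> nat) : (\sum_(i < n.+1) e i * N ^ i =
    (\sum_(i < n) e i.+1 * N ^ i) * N + e 0)%N.
  rewrite big_ord_recl expn0 muln1 addnC big_distrl /=; congr (_ + _)%N.
  by apply: eq_bigr => i _; rewrite /bump /= add1n expnSr mulnA.
rewrite !digit0 => e.
have e0 : f 0%N = g 0%N.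
  by move/(congr1 (modn^~ N)): e; rewrite !modnMDl !modn_small.
move=> [_ //|i ltin]; apply: (IHn (f \o succn) (g \o succn)) => //=.
by apply/eqP; rewrite -(eqn_pmul2r N_gt0) -(eqn_add2r (f 0%N)) {2}e0 e.
Qed.

(** Kronecker substitution: replacing the variable of index i by t ^ (N ^ i),
    with N larger than all exponents, sends distinct monomials to distinct
    powers of t, which reduces the claim to one variable. *)
Lemma mpoly_fun_eq0 (K : closedFieldType) (n : nat) (p : {mpoly K[n]}) :
  (forall v, p.@[v] = 0) -> p = 0.
Proof.
move=> p0; set N := msize p.
pose kappa (m : 'X_{1..n}) := (\sum_(i < n) m i * N ^ i)%N.
have kappa_inj : {in msupp p &, injective kappa}.
  move=> m m' pm pm' e; apply/mnmP => i.
  pose dig (m : 'X_{1..n}) j := oapp m 0%N (insub j).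
  have digE (l : 'X_{1..n}) (j : 'I_n) : dig l j = l j by rewrite /dig valK.
  have ltdig (l : 'X_{1..n}) j : l \in msupp p -> (dig l j < N)%N.
    move=> pl; apply: leq_trans (msize_mdeg_lt pl).
    rewrite ltnS /dig; case: insubP => //= k _ _.
    by rewrite mdegE (bigD1 k) //= leq_addr.
  rewrite -!digE.
  apply: (digits_inj (fun j => ltdig m j pm) (fun j => ltdig m' j pm')) => //.
  move: e; rewrite /kappa => e.
  by under eq_bigr do rewrite digE; under [RHS]eq_bigr do rewrite digE.
pose q := \sum_(m <- msupp p) p@_m *: 'X^(kappa m).
have q0 : q = 0.
  apply: poly_fun_eq0 => t; rewrite -(p0 (fun i => t ^+ (N ^ i))) mevalE.
  rewrite horner_sum; apply: eq_bigr => m _.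
  rewrite hornerZ hornerXn expr_sum; congr (_ * _).
  by apply: eq_bigr => i _; rewrite mulnC exprM.
apply/mpolyP => m; rewrite mcoeff0.
case: (boolP (m \in msupp p)) => [pm|/memN_msupp_eq0 //].
have := congr1 (fun r : {poly K} => r`_(kappa m)) q0; rewrite coef0 => <-.
rewrite coef_sum (bigD1_seq m) ?msupp_uniq //= coefZ coefXn eqxx mulr1.
rewrite big_seq_cond big1 ?addr0 // => m' /andP[pm' m'm].
rewrite coefZ coefXn; case: eqP => [e|_]; last by rewrite mulr0.
by rewrite (kappa_inj _ _ pm pm' e) eqxx in m'm.
Qed.

Lemma mpoly_line (K : fieldType) (n : nat) (p : {mpoly K[n]})
    (u v : 'I_n -> K) :
  exists q : {poly K}, forall t, q.[t] = p.@[fun i => u i + t * v i].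
Proof.
exists (\sum_(m <- msupp p) p@_m *: \prod_i ((u i)%:P + v i *: 'X) ^+ m i).
move=> t; rewrite mevalE horner_sum; apply: eq_bigr => m _.
rewrite hornerZ horner_prod; congr (_ * _); apply: eq_bigr => i _.
by rewrite horner_exp hornerD hornerC hornerZ hornerX mulrC.
Qed.

Section Classification.

Variable K : closedFieldType.
Implicit Types (w : poly_form K 3) (A : 'M[K]_3) (f : 'cV[K]_3 -> 'rV[K]_3).
Implicit Types (x y z m : K).

(** * Conjugacy through values *)

Definition values w (v : 'cV[K]_3) : 'rV[K]_3 :=
  \row_i (w 0 i).@[fun j => v j 0].

(** [conjugate_foliations] seen on values: a substitution acts on the column of
    coordinates, its matrix on the row of coefficients. *)
Definition conjugate_values f f' : Prop :=
  exists2 A : 'M[K]_3, A \in unitmx &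
    exists2 k : K, k != 0 & forall v, f' (A *m v) *m A = k *: f v.

Lemma form_pullback_linearE A w j :
  form_pullback (linear_subst A) w 0 j
    = \sum_i (w 0 i \mPo linear_subst A) * (A i j)%:MP.
Proof.
rewrite /form_pullback summxE; apply: eq_bigr => i _.
rewrite !mxE tnth_mktuple; congr (_ * _).
rewrite linear_sum (bigD1 j) //= big1 => [|l lj].
  rewrite addr0 mderivZ mderivX mnm1E eqxx scale1r.
  have -> : (U_(j) - U_(j))%MM = 0%MM :> 'X_{1..3}.
    by apply/mnmP => l; rewrite mnmBE subnn mnm0E.
  by rewrite mpolyX0 -mul_mpolyC mulr1.
by rewrite mderivZ mderivX mnm1E (negPf lj) scale0r scaler0.
Qed.

Lemma values_pullback A w v :
  values (form_pullback (linear_subst A) w) v = values w (A *m v) *m A.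
Proof.
apply/rowP => j; rewrite !mxE form_pullback_linearE raddf_sum /=.
apply: eq_bigr => i _; rewrite mevalM mevalC mxE comp_mpoly_meval.
congr (_ * _); apply: meval_eq => l.
rewrite tnth_mktuple raddf_sum mxE; apply: eq_bigr => m _ /=.
by rewrite mevalZ mevalXU.
Qed.

Lemma values_inj w w' : values w =1 values w' -> w = w'.
Proof.
move=> e; apply/rowP => i; apply/eqP; rewrite -subr_eq0; apply/eqP.
apply: mpoly_fun_eq0 => v; rewrite mevalB.
have /rowP/(_ i) := e (\col_j v j); rewrite !mxE.
have ev (p : {mpoly K[3]}) : p.@[fun j => (\col_j v j) j 0] = p.@[v].
  by apply: meval_eq => j; rewrite mxE.
by rewrite !ev => ->; rewrite subrr.
Qed.

Lemma values_scale (k : K) w v : values (k%:MP *: w) v = k *: values w v.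
Proof. by apply/rowP => i; rewrite !mxE mevalM mevalC. Qed.

Lemma conjugate_valuesP w w' :
  conjugate_foliations w w' <-> conjugate_values (values w) (values w').
Proof.
split=> [[A uA [k k0 e]]|[A uA [k k0 e]]]; exists A => //; exists k => //.
  by move=> v; rewrite -values_pullback e values_scale.
by apply: values_inj => v; rewrite values_pullback values_scale e.
Qed.

Lemma conjugate_values_trans f1 f2 f3 :
  conjugate_values f1 f2 -> conjugate_values f2 f3 -> conjugate_values f1 f3.
Proof.
move=> [A uA [k k0 eA]] [B uB [l l0 eB]].
exists (B *m A); first by rewrite unitmx_mul uB.
exists (k * l); first by rewrite mulf_neq0.
by move=> v; rewrite -mulmxA mulmxA eB -scalemxAl eA scalerA mulrC.
Qed.

Lemma conjugate_values_sym f1 f2 :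
  conjugate_values f1 f2 -> conjugate_values f2 f1.
Proof.
move=> [A uA [k k0 e]]; exists (invmx A); first by rewrite unitmx_inv.
exists k^-1; first by rewrite invr_eq0.
move=> v; have /(congr1 (mulmx^~ (invmx A))) := e (invmx A *m v).
rewrite mulKVmx // mulmxK // => ->.
by rewrite -scalemxAl scalerA mulVf // scale1r.
Qed.

Lemma conjugate_values_pullback A w :
  A \in unitmx ->
  conjugate_values (values (form_pullback (linear_subst A) w)) (values w).
Proof.
move=> uA; exists A => //; exists 1; first exact: oner_neq0.
by move=> v; rewrite values_pullback scale1r.
Qed.

(** A common divisor d has no zero off the axis X = Y = 0.  Any point with Y
    nonzero is joined to (1, 0, 0) by a line that avoids the axis, and on this
    line d has no zero, so is constant.  Hence d takes the same nonzero value at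
    all points with Y nonzero. *)
Lemma no_common_factor_of_zeros w :
  (forall v, (forall i, (w 0 i).@[v] = 0) -> v 0 = 0 /\ v 1 = 0) ->
  no_common_factor w.
Proof.
move=> zw d wd.
have zd v : d.@[v] = 0 -> v 0 = 0 /\ v 1 = 0.
  by move=> dv; apply: zw => i; have [q ->] := wd i; rewrite mevalM dv mul0r.
pose e0 : 'I_3 -> K := fun i => (i == 0)%:R.
have de0 : d.@[e0] != 0.
  by apply/eqP => /zd[/eqP]; rewrite /e0 eqxx oner_eq0.
have dconst v : v 1 != 0 -> d.@[v] = d.@[e0].
  move=> v1; have [q qE] := mpoly_line d e0 (fun i => v i - e0 i).
  have sq : size q == 1%N.
    apply/negPn/negP => /closed_rootP[t]; rewrite /root qE => /eqP /zd[].
    rewrite /e0 /= subr0 add0r => e /eqP; rewrite mulf_eq0 (negPf v1) orbF.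
    by move=> /eqP t0; move/eqP: e; rewrite t0 mul0r addr0 oner_eq0.
  have [c _ qc] := size_poly1P _ sq.
  have := qE 1; rewrite qc hornerC (_ : c = q.[0]); last by rewrite qc hornerC.
  rewrite qE (@meval_eq _ _ _ e0) => [->|i]; last by rewrite mul0r addr0.
  by apply: meval_eq => i; rewrite mul1r addrC subrK.
have X1 : 'X_1 != 0 :> {mpoly K[3]}.
  apply/eqP => /(congr1 (meval (fun=> 1))); rewrite mevalXU meval0 => /eqP.
  by rewrite oner_eq0.
have : 'X_1 * (d - d.@[e0]%:MP) = 0.
  apply: mpoly_fun_eq0 => v; rewrite mevalM mevalB mevalC mevalXU.
  have [->|v1] := eqVneq (v 1) 0; first by rewrite mul0r.
  by rewrite dconst // subrr mulr0.
move=> /eqP; rewrite mulf_eq0 (negPf X1) /= subr_eq0 => /eqP ->.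
by apply: rmorph_unit; rewrite unitfE.
Qed.

(** * Quadratic foliations singular at the vertex *)

(** The coefficients of P1, Q1, P2, Q2 and h; the 1-form P dy - Q dx with
    P = P1 + P2 + x h and Q = Q1 + Q2 + y h is the affine trace of a quadratic
    foliation singular at the origin.  Coefficients are
    functions of an index, of which [lin] and [quad] read the first two and
    three values. *)
Record germ := Germ { gP1 : nat -> K; gQ1 : nat -> K;
                      gP2 : nat -> K; gQ2 : nat -> K; gh : nat -> K }.

Definition lin (R : pzRingType) (l : nat -> R) (x y : R) : R :=
  l 0%N * x + l 1%N * y.
Definition quad (R : pzRingType) (q : nat -> R) (x y : R) : R :=
  q 0%N * x ^+ 2 + q 1%N * (x * y) + q 2%N * y ^+ 2.

(** The foliation is tangent to the line joining (x : y : z) to the vertex where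
    z polar2 + polar3 = 0; polar2 = 0 gives the tangents to this cubic at the
    vertex. *)
Definition polar2 (D : germ) (x y : K) :=
  x * lin (gQ1 D) x y - y * lin (gP1 D) x y.
Definition polar3 (D : germ) (x y : K) :=
  x * quad (gQ2 D) x y - y * quad (gP2 D) x y.

(** Kept apart from [germ_form], so that computations take place in K. *)
Definition germ_values (D : germ) (v : 'cV[K]_3) : 'rV[K]_3 :=
  let x := v 0 0 in let y := v 1 0 in let z := v 2 0 in
  \row_(i < 3)
    [:: - (lin (gQ1 D) x y * z ^+ 2 + quad (gQ2 D) x y * z
           + y * quad (gh D) x y);
        lin (gP1 D) x y * z ^+ 2 + quad (gP2 D) x y * z + x * quad (gh D) x y;
        z * polar2 D x y + polar3 D x y]`_i.

Definition germ_form (D : germ) : poly_form K 3 :=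
  let x : {mpoly K[3]} := 'X_0 in
  let y : {mpoly K[3]} := 'X_1 in
  let z : {mpoly K[3]} := 'X_2 in
  let C (e : nat -> K) n := (e n)%:MP in
  let P1 := lin (C (gP1 D)) x y in let Q1 := lin (C (gQ1 D)) x y in
  let P2 := quad (C (gP2 D)) x y in let Q2 := quad (C (gQ2 D)) x y in
  let h := quad (C (gh D)) x y in
  \row_(i < 3)
    [:: - (Q1 * z ^+ 2 + Q2 * z + y * h); P1 * z ^+ 2 + P2 * z + x * h;
        z * (x * Q1 - y * P1) + (x * Q2 - y * P2)]`_i.

Lemma ord3P (P : 'I_3 -> Prop) : P 0 -> P 1 -> P 2 -> forall i, P i.
Proof.
move=> P0 P1 P2 [[|[|[|//]]] lti];
  [move: P0|move: P1|move: P2]; congr P; exact/val_inj.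
Qed.

Definition vec3 (x y z : K) : 'cV[K]_3 := \col_(i < 3) [:: x; y; z]`_i.

Lemma vec3E (v : 'cV[K]_3) : v = vec3 (v 0 0) (v 1 0) (v 2 0).
Proof. by apply/colP; apply: ord3P; rewrite mxE. Qed.

Lemma values_germ_form D v : values (germ_form D) v = germ_values D v.
Proof.
apply/rowP; apply: ord3P; rewrite !mxE /= /lin /quad /polar2 /polar3 /lin /quad;
by rewrite !(mevalD, mevalN, mevalM, rmorphXn, mevalC, mevalXU, mevalB) /=.
Qed.

Lemma sum3 (V : nmodType) (F : 'I_3 -> V) : \sum_i F i = F 0 + F 1 + F 2.
Proof.
rewrite !big_ord_recl big_ord0 addr0 addrA.
by congr (_ + F _ + F _); apply/val_inj.
Qed.

Lemma germ_form_foliation D :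
  (forall i, germ_form D 0 i \is 3.-homog) /\
  \sum_i germ_form D 0 i * 'X_i = 0.
Proof.
have homX (i : 'I_3) : ('X_i : {mpoly K[3]}) \is 1.-homog.
  by rewrite dhomogX /= mdeg1.
have homC (c : K) : (c%:MP : {mpoly K[3]}) \is 0.-homog.
  by rewrite -[c%:MP]mulr1 mul_mpolyC dhomogZ ?dhomog1.
have homM d e (p q : {mpoly K[3]}) : p \is d.-homog -> q \is e.-homog ->
    p * q \is (d + e).-homog by exact: dhomogM.
have homlin l : lin (fun n => (l n : K)%:MP) 'X_0 ('X_1 : {mpoly K[3]})
    \is 1.-homog by rewrite rpredD // (homM 0%N 1%N).
have homquad l : quad (fun n => (l n : K)%:MP) 'X_0 ('X_1 : {mpoly K[3]})
    \is 2.-homog.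
  by rewrite !rpredD // (homM 0%N 2) // (homM 1%N 1%N).
split; last first.
  by rewrite sum3 !mxE /= /lin /quad; ring.
have homX2 (i : 'I_3) : ('X_i ^+ 2 : {mpoly K[3]}) \is 2.-homog.
  exact: (homM 1%N 1%N).
apply: ord3P; rewrite !mxE /= ?dhomogN; apply: rpredD; try apply: rpredD.
- exact: (homM 1%N 2).
- exact: (homM 2 1%N).
- exact: (homM 1%N 2).
- exact: (homM 1%N 2).
- exact: (homM 2 1%N).
- exact: (homM 1%N 2).
- apply: (homM 1%N 2) => //.
  by apply: rpredD; rewrite ?dhomogN; apply: (homM 1%N 1%N).
- exact: (homM 1%N 2).
- by rewrite dhomogN; exact: (homM 1%N 2).
Qed.

(** * From foliations to germs *)

Definition cubic (c : nat -> K) (x y z : K) : K :=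
  c 0%N * x ^+ 3 + c 1%N * x ^+ 2 * y + c 2%N * x ^+ 2 * z + c 3%N * x * y ^+ 2
  + c 4%N * x * y * z + c 5%N * x * z ^+ 2 + c 6%N * y ^+ 3 + c 7%N * y ^+ 2 * z
  + c 8%N * y * z ^+ 2 + c 9%N * z ^+ 3.

Lemma monomial_cubic (i j k : nat) : (i + j + k = 3)%N ->
  exists c, forall x y z : K, x ^+ i * y ^+ j * z ^+ k = cubic c x y z.
Proof.
case: i j k => [|[|[|[|i]]]] [|[|[|[|j]]]] [|[|[|[|k]]]] //= _.
1: exists (fun n => (n == 9%N)%:R).
2: exists (fun n => (n == 8%N)%:R).
3: exists (fun n => (n == 7%N)%:R).
4: exists (fun n => (n == 6%N)%:R).
5: exists (fun n => (n == 5%N)%:R).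
6: exists (fun n => (n == 4%N)%:R).
7: exists (fun n => (n == 3%N)%:R).
8: exists (fun n => (n == 2%N)%:R).
9: exists (fun n => (n == 1%N)%:R).
10: exists (fun n => (n == 0%N)%:R).
all: by move=> x y z; rewrite /cubic /=; ring.
Qed.

Lemma homog3_cubic (p : {mpoly K[3]}) : p \is 3.-homog ->
  exists c, forall v, p.@[v] = cubic c (v 0) (v 1) (v 2).
Proof.
move=> /dhomogP hp; rewrite [p]mpolyE big_seq.
elim/big_rec: _ => [|m q pm [c qE]].
  by exists (fun=> 0) => v; rewrite meval0 /cubic; ring.
have := hp m pm; rewrite /= mdegE sum3 => /monomial_cubic[c' mE].
have {}mE v : ('X_[m] : {mpoly K[3]}).@[v] = cubic c' (v 0) (v 1) (v 2).
  rewrite mevalX -mE !big_ord_recl big_ord0 mulr1 mulrA.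
  by congr (v _ ^+ m _ * v _ ^+ m _ * v _ ^+ m _); exact/val_inj.
exists (fun n => p@_m * c' n + c n) => v.
by rewrite mevalD mevalZ mE qE /cubic; ring.
Qed.

(** The relation is a quartic form in three variables; its fifteen coefficients
    express all coefficients of a, b, c through thirteen of them, once those of
    Z^3 vanish. *)
Lemma germ_of_foliation (w : poly_form K 3) :
  (forall i, w 0 i \is 3.-homog) ->
  (forall v, values w v *m v = 0) ->
  values w (vec3 0 0 1) = 0 ->
  exists D, values w =1 germ_values D.
Proof.
move=> hw contr sing.
have [a aE] := homog3_cubic (hw 0).
have [b bE] := homog3_cubic (hw 1).
have [c cE] := homog3_cubic (hw 2).
have wE v : values w v = \row_i [:: cubic a (v 0 0) (v 1 0) (v 2 0);
    cubic b (v 0 0) (v 1 0) (v 2 0); cubic c (v 0 0) (v 1 0) (v 2 0)]`_i.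
  by apply/rowP; apply: ord3P; rewrite !mxE /= ?aE ?bE ?cE.
have rel x y z : cubic a x y z * x + cubic b x y z * y + cubic c x y z * z = 0.
  have /matrixP/(_ 0 0) := contr (vec3 x y z).
  by rewrite wE mxE sum3 !mxE.
have [a9 b9 c9] : [/\ a 9%N = 0, b 9%N = 0 & c 9%N = 0].
  move/rowP: sing => e; move: (e 0) (e 1) (e 2); rewrite wE !mxE /=.
  rewrite /cubic !(expr0n, expr1n, mulr0, mul0r, mulr1, add0r) /=.
  by rewrite ?(mulr0, mul0r, mulr1, add0r, addr0) => -> -> ->.
pose s0 := [:: a 0%N; b 0%N + a 1%N; b 1%N + a 3%N; b 3%N + a 6%N; b 6%N].
pose s1 := [:: a 2%N + c 0%N; a 4%N + b 2%N + c 1%N; a 7%N + b 4%N + c 3%N;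
               b 7%N + c 6%N].
pose s2 := [:: a 5%N + c 2%N; a 8%N + b 5%N + c 4%N; b 8%N + c 7%N].
pose s3 := [:: a 9%N + c 5%N; b 9%N + c 8%N].
(* Each s_k lists, by powers of y, the coefficient of z ^ k in the relation
   dehomogenized at x = 1. *)
have coefz y : forall i, [:: (Poly s0).[y]; (Poly s1).[y]; (Poly s2).[y];
    (Poly s3).[y]; c 9%N]`_i = 0.
  apply: Poly_coef_eq0 => z; rewrite -[RHS](rel 1 y z) !horner_Poly /= /cubic.
  by ring.
have e0 := Poly_coef_eq0 (fun y => coefz y 0%N).
have e1 := Poly_coef_eq0 (fun y => coefz y 1%N).
have e2 := Poly_coef_eq0 (fun y => coefz y 2%N).
have e3 := Poly_coef_eq0 (fun y => coefz y 3%N).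
have solve u v : u + v = 0 :> K -> v = - u by move=> /addr0_eq.
have a0 : a 0%N = 0 := e0 0%N.
have a1 : a 1%N = - b 0%N := solve _ _ (e0 1%N).
have a3 : a 3%N = - b 1%N := solve _ _ (e0 2%N).
have a6 : a 6%N = - b 3%N := solve _ _ (e0 3%N).
have b6 : b 6%N = 0 := e0 4%N.
have c0 : c 0%N = - a 2%N := solve _ _ (e1 0%N).
have c1 : c 1%N = - (a 4%N + b 2%N) := solve _ _ (e1 1%N).
have c3 : c 3%N = - (a 7%N + b 4%N) := solve _ _ (e1 2%N).
have c6 : c 6%N = - b 7%N := solve _ _ (e1 3%N).
have c2 : c 2%N = - a 5%N := solve _ _ (e2 0%N).
have c4 : c 4%N = - (a 8%N + b 5%N) := solve _ _ (e2 1%N).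
have c7 : c 7%N = - b 8%N := solve _ _ (e2 2%N).
have c5 : c 5%N = - a 9%N := solve _ _ (e3 0%N).
have c8 : c 8%N = - b 9%N := solve _ _ (e3 1%N).
exists (Germ (fun n => [:: b 5%N; b 8%N]`_n) (fun n => [:: - a 5%N; - a 8%N]`_n)
  (fun n => [:: b 2%N; b 4%N; b 7%N]`_n)
  (fun n => [:: - a 2%N; - a 4%N; - a 7%N]`_n)
  (fun n => [:: b 0%N; b 1%N; b 3%N]`_n)) => v.
rewrite wE; apply/rowP; apply: ord3P;
  rewrite !mxE /= /polar2 /polar3 /lin /quad /cubic /=.
- by rewrite a0 a1 a3 a6 a9; ring.
- by rewrite b6 b9; ring.
- by rewrite c0 c1 c2 c3 c4 c5 c6 c7 c8 a9 b9 c9; ring.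
Qed.

(** * The other singular points *)

(** The vertex is the only singular point. *)
Definition isolated D : Prop :=
  forall v, germ_values D v = 0 -> v 0 0 = 0 /\ v 1 0 = 0.

(** What remains of the equations of the singular points on the rational cubic
    z polar2 + polar3 = 0, in the parameter (x : y). *)
Definition polar_res D x y : K :=
  polar3 D x y * (lin (gP1 D) x y * quad (gQ2 D) x y
                - lin (gQ1 D) x y * quad (gP2 D) x y)
  + quad (gh D) x y * polar2 D x y ^+ 2.

(** The point (x polar2, y polar2, - polar3) is on the cubic, and there the
    coefficients of dX and dY are - y polar2 R and x polar2 R, where R is the
    sextic. *)
Lemma polar_res_neq0 D x y :
  isolated D -> polar2 D x y != 0 -> polar_res D x y != 0.
Proof.
move=> isoD phi0; apply/eqP => res0; have [] : x = 0 /\ y = 0.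
  suff /isoD[] :
      germ_values D (vec3 (x * polar2 D x y) (y * polar2 D x y)
                          (- polar3 D x y)) = 0.
    rewrite !mxE /= => /eqP + /eqP.
    by rewrite !mulf_eq0 (negPf phi0) !orbF => /eqP-> /eqP->.
  have bR : polar2 D x y * x * polar_res D x y = 0 by rewrite res0 mulr0.
  have aR : - (polar2 D x y * y * polar_res D x y) = 0.
    by rewrite res0 mulr0 oppr0.
  apply/rowP; apply: ord3P; rewrite !mxE /=.
  - by rewrite -[RHS]aR /polar_res /polar2 /polar3 /lin /quad; ring.
  - by rewrite -[RHS]bR /polar_res /polar2 /polar3 /lin /quad; ring.
  - by rewrite /polar2 /polar3 /lin /quad; ring.
by move=> x0 y0; rewrite /polar2 x0 y0 !mul0r subrr eqxx in phi0.
Qed.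

Lemma proportional x y u v : (x != 0) || (y != 0) -> x * v - y * u = 0 ->
  exists t, u = t * x /\ v = t * y.
Proof.
move=> xy0 /eqP; rewrite subr_eq0 => /eqP e.
case: (eqVneq x 0) xy0 => [x0 /= y0|x0 _].
  exists (v / y); rewrite divfK //; split=> //.
  by move/eqP: e; rewrite x0 mul0r eq_sym mulf_eq0 (negPf y0) mulr0 => /eqP.
by exists (u / x); rewrite divfK // mulrAC [u * y]mulrC -e mulrAC mulfV ?mul1r.
Qed.

(** In this direction the linear and quadratic parts are multiples s and t of
    (x, y), and the line joining (x : y : 0) to the vertex meets the singular
    set where s z^2 + t z + h(x, y) = 0; without solution, this polynomial in z
    is a nonzero constant. *)
Lemma polar_line D x y : isolated D -> (x != 0) || (y != 0) ->
  polar2 D x y = 0 -> polar3 D x y = 0 ->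
  [/\ lin (gP1 D) x y = 0, lin (gQ1 D) x y = 0,
      quad (gP2 D) x y = 0, quad (gQ2 D) x y = 0 & quad (gh D) x y != 0].
Proof.
move=> isoD xy0 phi2 phi3.
have [s [Ps Qs]] := proportional xy0 phi2.
have [t [Pt Qt]] := proportional xy0 phi3.
have noroot z : (Poly [:: quad (gh D) x y; t; s]).[z] != 0.
  rewrite horner_Poly /=; apply/eqP => e.
  suff /isoD[] : germ_values D (vec3 x y z) = 0.
    by rewrite !mxE /= => x0 y0; rewrite x0 y0 eqxx in xy0.
  apply/rowP; apply: ord3P; rewrite !mxE /= ?phi2 ?phi3.
  - by rewrite Qs Qt -[RHS](mulr0 (- y)) -e; ring.
  - by rewrite Ps Pt -[RHS](mulr0 x) -e; ring.
  - by rewrite mulr0 addr0.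
have t0 : t = 0 := Poly_rootless noroot 0%N.
have s0 : s = 0 := Poly_rootless noroot 1%N.
have := noroot 0; rewrite horner_Poly /= mulr0 add0r => h0.
by split; rewrite // ?Ps ?Qs ?Pt ?Qt ?s0 ?t0 mul0r.
Qed.

(** * Changes of coordinates *)

Definition mx3 (a b c d e f g h i : K) : 'M[K]_3 :=
  \matrix_(r < 3, s < 3)
    [:: [:: a; b; c]`_s; [:: d; e; f]`_s; [:: g; h; i]`_s]`_r.

Lemma mx3_vec3 (a b c d e f g h i x y z : K) :
  mx3 a b c d e f g h i *m vec3 x y z
    = vec3 (a * x + b * y + c * z) (d * x + e * y + f * z)
           (g * x + h * y + i * z).
Proof. by apply/colP; apply: ord3P; rewrite mxE sum3 !mxE. Qed.

(** The matrices used fix the vertex, so that they are block triangular; this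
    reduces a conjugacy to three identities between coefficients. *)
Lemma conjugate_by_block (a b c d r s t k : K)
    (f f' : 'cV[K]_3 -> 'rV[K]_3) :
  a * d - b * c != 0 -> t != 0 -> k != 0 ->
  (forall x y z,
    let w :=
      f' (vec3 (a * x + b * y) (c * x + d * y) (r * x + s * y + t * z)) in
    [/\ w 0 0 * a + w 0 1 * c + w 0 2 * r = k * f (vec3 x y z) 0 0,
        w 0 0 * b + w 0 1 * d + w 0 2 * s = k * f (vec3 x y z) 0 1
      & w 0 2 * t = k * f (vec3 x y z) 0 2]) ->
  conjugate_values f f'.
Proof.
move=> det0 t0 k0 e; exists (mx3 a b 0 c d 0 r s t).
  pose D := a * d - b * c.
  pose B := mx3 (d / D) (- b / D) 0 (- c / D) (a / D) 0
     ((c * s - d * r) / (D * t)) ((b * r - a * s) / (D * t)) t^-1.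
  suff /mulmx1_unit[] : mx3 a b 0 c d 0 r s t *m B = 1%:M by [].
  apply/matrixP; apply: ord3P; apply: ord3P; rewrite mxE sum3 !mxE /= /D;
    by field; rewrite ?t0 ?det0.
exists k => // v; rewrite [v]vec3E mx3_vec3.
have [e0 e1 e2] := e (v 0 0) (v 1 0) (v 2 0).
rewrite !mul0r !addr0; apply/rowP; apply: ord3P;
  rewrite !mxE -?e0 -?e1 -?e2 sum3 !mxE //=.
by rewrite !mulr0 !add0r.
Qed.

Definition lin_subst (l : nat -> K) (a b c d : K) (n : nat) : K :=
  if n is 0 then lin l a c else lin l b d.
Definition quad_subst (q : nat -> K) (a b c d : K) (n : nat) : K :=
  match n with
  | 0 => quad q a c
  | 1 => 2 * q 0%N * a * b + q 1%N * (a * d + b * c) + 2 * q 2%N * c * d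
  | _ => quad q b d
  end.

Lemma det_neq0_ker (a b c d x y : K) : a * d - b * c != 0 ->
  a * x + b * y = 0 -> c * x + d * y = 0 -> x = 0 /\ y = 0.
Proof.
move=> det0 e1 e2; split; apply: (mulfI det0); rewrite mulr0.
  transitivity (d * (a * x + b * y) - b * (c * x + d * y)); first by ring.
  by rewrite e1 e2 !mulr0 subrr.
transitivity (a * (c * x + d * y) - c * (a * x + b * y)); first by ring.
by rewrite e1 e2 !mulr0 subrr.
Qed.

(** A linear change of coordinates B multiplies the vector field by the
    adjugate of B, which keeps its coefficients polynomial in those of B; the
    coefficient of dZ is only substituted into, hence the behaviour of polar2
    and polar3. *)
Lemma germ_linear_change D (a b c d : K) : a * d - b * c != 0 -> isolated D ->
  exists D', [/\ isolated D',
    conjugate_values (germ_values D') (germ_values D),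
    forall x y, lin (gP1 D') x y
      = d * lin (gP1 D) (a * x + b * y) (c * x + d * y)
        - b * lin (gQ1 D) (a * x + b * y) (c * x + d * y),
    forall x y, polar2 D' x y = polar2 D (a * x + b * y) (c * x + d * y)
  & forall x y, polar3 D' x y = polar3 D (a * x + b * y) (c * x + d * y)].
Proof.
move=> det0 isoD.
pose L l := lin_subst l a b c d; pose S q := quad_subst q a b c d.
pose D' := Germ (fun n => d * L (gP1 D) n - b * L (gQ1 D) n)
                (fun n => a * L (gQ1 D) n - c * L (gP1 D) n)
                (fun n => d * S (gP2 D) n - b * S (gQ2 D) n)
                (fun n => a * S (gQ2 D) n - c * S (gP2 D) n)
                (fun n => (a * d - b * c) * S (gh D) n).
have valE x y z :
    let w := germ_values D (vec3 (a * x + b * y) (c * x + d * y) z) in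
    [/\ w 0 0 * a + w 0 1 * c = germ_values D' (vec3 x y z) 0 0,
        w 0 0 * b + w 0 1 * d = germ_values D' (vec3 x y z) 0 1
      & w 0 2 = germ_values D' (vec3 x y z) 0 2].
  split; rewrite !mxE /= /polar2 /polar3 /lin /quad /L /S /lin_subst;
    by rewrite /quad_subst /= /lin /quad /=; ring.
exists D'; split.
- move=> v v0; have := isoD (vec3 (a * v 0 0 + b * v 1 0)
                                  (c * v 0 0 + d * v 1 0) (v 2 0)).
  have := valE (v 0 0) (v 1 0) (v 2 0); rewrite -vec3E v0.
  move: (germ_values D _) => w /= []; rewrite !mxE /= => e0 e1 e2 isow.
  have [|ex ey] := isow; last exact: det_neq0_ker det0 ex ey.
  have [|||w0 w1] := @det_neq0_ker a c b d (w 0 0) (w 0 1).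
  - by rewrite [c * b]mulrC.
  - by rewrite mulrC [c * _]mulrC.
  - by rewrite mulrC [d * _]mulrC.
  by apply/rowP; apply: ord3P; rewrite ?w0 ?w1 ?e2 mxE.
- apply: (conjugate_by_block (a := a) (b := b) (c := c) (d := d)
                            (r := 0) (s := 0) (t := 1) (k := 1)) => //;
    rewrite ?oner_neq0 //.
  move=> x y z w; rewrite !mulr0 !addr0 mulr1 !mul1r.
  by rewrite /w !mul0r !add0r mul1r; exact: valE.
- by move=> x y; rewrite /lin /L /lin_subst /= /lin /=; ring.
- by move=> x y; rewrite /polar2 /lin /L /lin_subst /= /lin /=; ring.
- by move=> x y; rewrite /polar3 /quad /S /quad_subst /= /quad /=; ring.
Qed.

(** * Reduction to the normal forms *)

(** The four normal forms, read off from P dy - Q dx. *)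
Definition normal_germ (i : nat) : germ :=
  let s (l : seq K) n := l`_n in
  match i with
  | 0 => Germ (s [::]) (s [::]) (s [::]) (s [:: -1]) (s [:: 0; 0; 1])
  | 1 => Germ (s [::]) (s [::]) (s [:: 1]) (s [:: -1; 1]) (s [:: 0; 0; 1])
  | 2 => Germ (s [::]) (s [::]) (s [::]) (s [:: 0; -1]) (s [:: 1; 0; 1])
  | _ => Germ (s [:: 1]) (s [::]) (s [:: 0; 0; 1]) (s [:: -1]) (s [:: 0; -1])
  end.

Definition reduces_to D i :=
  conjugate_values (germ_values D) (germ_values (normal_germ i)).

Definition no_linear_part D :=
  [/\ gP1 D 0%N = 0, gP1 D 1%N = 0, gQ1 D 0%N = 0 & gQ1 D 1%N = 0].

Lemma closed_nth_root (n : nat) (c : K) : exists t : K, t ^+ n.+1 = c.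
Proof.
have /closed_rootP[t] : size ('X^(n.+1) - c%:P) != 1%N by rewrite size_XnsubC.
by rewrite /root !hornerE subr_eq0 => /eqP <-; exists t.
Qed.

(** Completing the square, which divides by 2, removes the middle term of h. *)
Lemma reduces_to_normal1 D : (2 : K) != 0 -> no_linear_part D ->
  [/\ gP2 D 0%N = 0, gP2 D 1%N = 0 & gP2 D 2%N = 0] ->
  [/\ gQ2 D 0%N != 0, gQ2 D 1%N = 0 & gQ2 D 2%N = 0] ->
  gh D 2%N != 0 -> reduces_to D 0.
Proof.
move=> n2 [l0 l1 m0 m1] [p0 p1 p2] [q0 q1 q2] h2.
pose s := gh D 1%N / (2 * gh D 2%N).
pose r := s ^+ 2 - gh D 0%N / gh D 2%N.
apply: (conjugate_by_block (a := 1) (b := 0) (c := s) (d := 1) (r := 0) (s := r)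
  (t := - gQ2 D 0%N / gh D 2%N) (k := (gh D 2%N)^-1)).
- by rewrite mulr1 mul0r subr0 oner_neq0.
- by rewrite mulf_neq0 ?oppr_eq0 ?invr_eq0.
- by rewrite invr_eq0.
move=> x y z; rewrite /= !mxE /= /polar2 /polar3 /lin /quad /=.
rewrite l0 l1 m0 m1 p0 p1 p2 q1 q2 /r /s.
by split; field; rewrite ?n2 ?h2.
Qed.

(** As P2 = p x^2 with p nonzero contributes p x^2 z to the coefficient of dY, a
    change of Z absorbs the coefficients of x^2 and xy in h. *)
Lemma reduces_to_normal2 D : no_linear_part D ->
  [/\ gP2 D 0%N != 0, gP2 D 1%N = 0 & gP2 D 2%N = 0] ->
  [/\ gQ2 D 0%N != 0, gQ2 D 1%N = gP2 D 0%N & gQ2 D 2%N = 0] ->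
  gh D 2%N != 0 -> reduces_to D 1.
Proof.
move=> [l0 l1 m0 m1] [p0 p1 p2] [q0 q1 q2] h2.
pose mu := - gP2 D 0%N / gQ2 D 0%N.
have mu0 : mu != 0 by rewrite mulf_neq0 ?oppr_eq0 ?invr_eq0.
pose k := mu ^+ 3 / gh D 2%N.
have k0 : k != 0 by rewrite mulf_neq0 ?expf_neq0 ?invr_eq0.
pose s := k * gh D 1%N / mu.
apply: (conjugate_by_block (a := 1) (b := 0) (c := 0) (d := mu)
  (r := (k * gh D 0%N + s) / mu) (s := s) (t := - k * gQ2 D 0%N)
  (k := k)) => //.
- by rewrite mul1r mul0r subr0.
- by rewrite mulf_neq0 ?oppr_eq0.
move=> x y z; rewrite /= !mxE /= /polar2 /polar3 /lin /quad /=.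
rewrite l0 l1 m0 m1 p1 p2 q1 q2 /s /k /mu.
by split; field; rewrite ?oppr_eq0 ?p0 ?q0 ?h2.
Qed.

(** A change of Z absorbs the coefficient of xy in h; the ratio of the other two
    is normalized by a square root. *)
Lemma reduces_to_normal3 D : no_linear_part D ->
  [/\ gP2 D 0%N = 0, gP2 D 1%N = 0 & gP2 D 2%N = 0] ->
  [/\ gQ2 D 0%N = 0, gQ2 D 1%N != 0 & gQ2 D 2%N = 0] ->
  gh D 0%N != 0 -> gh D 2%N != 0 -> reduces_to D 2.
Proof.
move=> [l0 l1 m0 m1] [p0 p1 p2] [q0 q1 q2] h0 h2.
have [mu mu2] := closed_nth_root 1 (gh D 2%N / gh D 0%N).
have mu0 : mu != 0.
  suff : mu ^+ 2 != 0 by rewrite expf_eq0.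
  by rewrite mu2 mulf_neq0 ?invr_eq0.
have {mu2} h2E : gh D 2%N = mu ^+ 2 * gh D 0%N by rewrite mu2 divfK.
apply: (conjugate_by_block (a := 1) (b := 0) (c := 0) (d := mu) (r := 0)
  (s := - gh D 1%N / gh D 0%N) (t := - gQ2 D 1%N / gh D 0%N)
  (k := mu / gh D 0%N)).
- by rewrite mul1r mul0r subr0.
- by rewrite mulf_neq0 ?oppr_eq0 ?invr_eq0.
- by rewrite mulf_neq0 ?oppr_eq0 ?invr_eq0.
move=> x y z; rewrite /= !mxE /= /polar2 /polar3 /lin /quad /=.
rewrite l0 l1 m0 m1 p0 p1 p2 q0 q2 h2E.
by split; field; rewrite ?h0.
Qed.

(** The hypotheses on P2 and Q2 say that the cubic c = 0 is, up to factors,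
    X^3 + X Y Z' + Y^3 with Z' = Z + (s X + r Y) / al, where s and r are the
    coefficients of xy in Q2 and P2 and al is the nonzero eigenvalue; the
    remaining scaling needs a cube root. *)
Lemma reduces_to_normal4 D :
  [/\ gP1 D 0%N != 0, gP1 D 1%N = 0, gQ1 D 0%N = 0 & gQ1 D 1%N = 0] ->
  [/\ gP2 D 0%N = 2 * gQ2 D 1%N & gP2 D 2%N != 0] ->
  [/\ gQ2 D 0%N != 0 & gQ2 D 2%N = 0] ->
  [/\ gP1 D 0%N * gh D 0%N = gQ2 D 1%N ^+ 2 + gP2 D 1%N * gQ2 D 0%N,
      gP1 D 0%N * gh D 1%N = gP2 D 1%N * gQ2 D 1%N + gP2 D 2%N * gQ2 D 0%N
    & gP1 D 0%N * gh D 2%N = gP2 D 2%N * gQ2 D 1%N] ->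
  reduces_to D 3.
Proof.
move=> [l0 l1 m0 m1] [p0 p2] [q0 q2] [h0 h1 h2].
set al := gP1 D 0%N in l0 h0 h1 h2.
have divE u v : al * u = v -> u = v / al by move=> <-; rewrite mulrC mulKf.
move/divE in h0; move/divE in h1; move/divE in h2.
have [mu mu3] := closed_nth_root 2 (- gQ2 D 0%N * gP2 D 2%N ^+ 2 / al ^+ 3).
have mu0 : mu != 0.
  suff : mu ^+ 3 != 0 by rewrite expf_eq0.
  by rewrite mu3 !mulf_neq0 ?invr_eq0 ?expf_neq0 ?oppr_eq0.
have q0E : gQ2 D 0%N = - mu ^+ 3 * al ^+ 3 / gP2 D 2%N ^+ 2.
  by rewrite mu3; field; rewrite l0 p2.
(* With la and mu, the coefficients of X^3 and Y^3 become proportional to the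
   coefficient of XYZ. *)
pose la := al * mu ^+ 2 / gP2 D 2%N.
have la0 : la != 0 by rewrite !mulf_neq0 ?invr_eq0 ?expf_neq0.
apply: (conjugate_by_block (a := la) (b := 0) (c := 0) (d := mu)
  (r := gQ2 D 1%N / al) (s := gP2 D 1%N / al) (t := 1) (k := la * mu / al)).
- by rewrite mul0r subr0 mulf_neq0.
- exact: oner_neq0.
- by rewrite !mulf_neq0 ?invr_eq0.
move=> x y z; rewrite /= !mxE /= /polar2 /polar3 /lin /quad /= -/al.
rewrite l1 m0 m1 p0 q2 h0 h1 h2 q0E /la.
by split; field; rewrite ?l0 ?p2.
Qed.

(** The same reduction with the roles of x and y exchanged. *)
Lemma reduces_to_normal3_swap D : no_linear_part D ->
  [/\ gP2 D 0%N = 0, gP2 D 1%N != 0 & gP2 D 2%N = 0] ->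
  [/\ gQ2 D 0%N = 0, gQ2 D 1%N = 0 & gQ2 D 2%N = 0] ->
  gh D 0%N != 0 -> gh D 2%N != 0 -> reduces_to D 2.
Proof.
move=> [l0 l1 m0 m1] [p0 p1 p2] [q0 q1 q2] h0 h2.
have [mu mu2] := closed_nth_root 1 (gh D 0%N / gh D 2%N).
have mu0 : mu != 0.
  suff : mu ^+ 2 != 0 by rewrite expf_eq0.
  by rewrite mu2 mulf_neq0 ?invr_eq0.
have {mu2} h0E : gh D 0%N = mu ^+ 2 * gh D 2%N by rewrite mu2 divfK.
apply: (conjugate_by_block (a := 0) (b := 1) (c := mu) (d := 0)
  (r := - gh D 1%N / gh D 2%N) (s := 0) (t := - gP2 D 1%N / gh D 2%N)
  (k := - mu / gh D 2%N)).
- by rewrite mul0r mul1r sub0r oppr_eq0.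
- by rewrite mulf_neq0 ?oppr_eq0 ?invr_eq0.
- by rewrite mulf_neq0 ?oppr_eq0 ?invr_eq0.
move=> x y z; rewrite /= !mxE /= /polar2 /polar3 /lin /quad /=.
rewrite l0 l1 m0 m1 p0 p2 q0 q1 q2 h0E.
by split; field; rewrite ?h2.
Qed.

(** * Classification *)

(** A binary form Phi of positive degree, given by its dehomogenization s and
    its value at (0, 1), has a zero.  Some basis of the plane consists of two
    zeros, unless all zeros are proportional; then the second vector of the
    basis is a zero, and there is no other. *)
Lemma binary_form_basis (Phi : K -> K -> K) (s : seq K) (i : nat) :
  (forall m, Phi 1 m = (Poly s).[m]) -> Phi 0 1 = s`_i.+1 ->
  exists a b c d, [/\ a * d - b * c != 0, Phi b d = 0
    & Phi a c = 0 \/ forall m, Phi (a + b * m) (c + d * m) != 0].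
Proof.
move=> PhiE Phi01.
have [b [d [bd0 Phibd]]] : exists b d, (b != 0) || (d != 0) /\ Phi b d = 0.
  have [[m Phim]|noroot] := EM (exists m, Phi 1 m = 0).
    by exists 1, m; rewrite oner_neq0.
  exists 0, 1; rewrite oner_neq0 orbT Phi01; split=> //.
  apply: Poly_rootless => m; rewrite -PhiE; apply/eqP => Phim.
  by apply: noroot; exists m.
have [a [c det0]] : exists a c, a * d - b * c != 0.
  have [b0|b0] := eqVneq b 0.
    by exists 1, 0; move: bd0; rewrite b0 eqxx mul1r mulr0 subr0.
  by exists 0, 1; rewrite mul0r mulr1 sub0r oppr_eq0.
have [[m Phim]|noroot] := EM (exists m, Phi (a + b * m) (c + d * m) = 0).
  exists (a + b * m), b, (c + d * m), d; split=> //; last by left.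
  by rewrite (_ : _ - _ = a * d - b * c) //; ring.
exists a, b, c, d; split=> //; right=> m; apply/eqP => Phim.
by apply: noroot; exists m.
Qed.

Lemma polar2_Poly D m : polar2 D 1 m =
  (Poly [:: gQ1 D 0%N; gQ1 D 1%N - gP1 D 0%N; - gP1 D 1%N]).[m].
Proof. by rewrite horner_Poly /= /polar2 /lin; ring. Qed.

Lemma polar3_Poly D m : polar3 D 1 m =
  (Poly [:: gQ2 D 0%N; gQ2 D 1%N - gP2 D 0%N; gQ2 D 2%N - gP2 D 1%N;
            - gP2 D 2%N]).[m].
Proof. by rewrite horner_Poly /= /polar3 /quad; ring. Qed.

Lemma polar2_01 D : polar2 D 0 1 = - gP1 D 1%N.
Proof. by rewrite /polar2 /lin; ring. Qed.

Lemma polar2_10 D : polar2 D 1 0 = gQ1 D 0%N.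
Proof. by rewrite /polar2 /lin; ring. Qed.

Lemma polar3_01 D : polar3 D 0 1 = - gP2 D 2%N.
Proof. by rewrite /polar3 /quad; ring. Qed.

Lemma polar3_10 D : polar3 D 1 0 = gQ2 D 0%N.
Proof. by rewrite /polar3 /quad; ring. Qed.

Lemma lin01 (l : nat -> K) : lin l 0 1 = l 1%N.
Proof. by rewrite /lin; ring. Qed.
Lemma lin10 (l : nat -> K) : lin l 1 0 = l 0%N.
Proof. by rewrite /lin; ring. Qed.
Lemma quad01 (l : nat -> K) : quad l 0 1 = l 2%N.
Proof. by rewrite /quad; ring. Qed.
Lemma quad10 (l : nat -> K) : quad l 1 0 = l 0%N.
Proof. by rewrite /quad; ring. Qed.

Lemma polar_line01 D : isolated D -> gP1 D 1%N = 0 -> gP2 D 2%N = 0 ->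
  [/\ gQ1 D 1%N = 0, gQ2 D 2%N = 0 & gh D 2%N != 0].
Proof.
move=> isoD l1 p2; have [|||_ + _ + +] := @polar_line D 0 1 isoD.
- by rewrite oner_neq0 orbT.
- by rewrite polar2_01 l1 oppr0.
- by rewrite polar3_01 p2 oppr0.
by rewrite lin01 !quad01 => -> ->.
Qed.

Lemma polar_line10 D : isolated D -> gQ1 D 0%N = 0 -> gQ2 D 0%N = 0 ->
  [/\ gP1 D 0%N = 0, gP2 D 0%N = 0 & gh D 0%N != 0].
Proof.
move=> isoD m0 q0; have [|||+ _ + _ +] := @polar_line D 1 0 isoD.
- by rewrite oner_neq0.
- by rewrite polar2_10.
- by rewrite polar3_10.
by rewrite lin10 !quad10 => -> ->.
Qed.

(** Here the linear part is al times the identity plus a nonzero nilpotent part,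
    and R(1, m) has no zero.  Its coefficients in degrees 6 and 5 show that the
    cubic contains the line x = 0; then al = 0 and h is nonzero on this line,
    while the coefficients in degrees 3 and 2 say that it vanishes. *)
Lemma single_tangent_absurd D : isolated D -> polar2 D 0 1 = 0 ->
  ~ (forall m, polar2 D 1 m != 0).
Proof.
move=> isoD; rewrite polar2_01 => /eqP; rewrite oppr_eq0 => /eqP l1 polar2m.
have Poly2 m :
    (Poly [:: gQ1 D 0%N; gQ1 D 1%N - gP1 D 0%N; - gP1 D 1%N]).[m] != 0.
  by rewrite -polar2_Poly.
have /eqP := Poly_rootless Poly2 0%N; rewrite /= subr_eq0 => /eqP m1.
have q0 : gQ1 D 0%N != 0.
  by have := Poly2 0; rewrite horner_Poly /= mulr0 add0r.
have Resm m : polar_res D 1 m != 0 by exact: polar_res_neq0.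
set q := gQ1 D 0%N in q0; set al := gP1 D 0%N in m1.
pose r0 := gP2 D 0%N; pose r1 := gP2 D 1%N; pose r2 := gP2 D 2%N.
pose s0 := gQ2 D 0%N; pose s1 := gQ2 D 1%N; pose s2 := gQ2 D 2%N.
pose h0 := gh D 0%N; pose h1 := gh D 1%N; pose h2 := gh D 2%N.
(* f and g list the coefficients in m of polar3 and P1 Q2 - Q1 P2 at (1, m). *)
pose f0 := s0; pose f1 := s1 - r0; pose f2 := s2 - r1; pose f3 := - r2.
pose g0 := al * f0 - q * r0; pose g1 := al * f1 - q * r1.
pose g2 := al * f2 - q * r2; pose g3 := al * f3.
have PolyR m : (Poly [:: f0 * g0 + q ^+ 2 * h0; f0 * g1 + f1 * g0 + q ^+ 2 * h1;
    f0 * g2 + f1 * g1 + f2 * g0 + q ^+ 2 * h2;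
    f0 * g3 + f1 * g2 + f2 * g1 + f3 * g0; f1 * g3 + f2 * g2 + f3 * g1;
    f2 * g3 + f3 * g2; f3 * g3]).[m] != 0.
  rewrite (_ : _.[m] = polar_res D 1 m) // horner_Poly /=.
  rewrite /polar_res /polar2 /polar3 /lin /quad l1 m1 -/q -/al.
  rewrite /g0 /g1 /g2 /g3 /f0 /f1 /f2 /f3.
  by rewrite /r0 /r1 /r2 /s0 /s1 /s2 /h0 /h1 /h2; ring.
have c2 : f0 * g2 + f1 * g1 + f2 * g0 + q ^+ 2 * h2 = 0 :=
  Poly_rootless PolyR 1%N.
have c3 : f0 * g3 + f1 * g2 + f2 * g1 + f3 * g0 = 0 := Poly_rootless PolyR 2%N.
have c5 : f2 * g3 + f3 * g2 = 0 := Poly_rootless PolyR 4%N.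
have c6 : f3 * g3 = 0 := Poly_rootless PolyR 5%N.
have r20 : r2 = 0.
  apply/eqP/negPn/negP => r20; have f30 : f3 != 0 by rewrite oppr_eq0.
  move/eqP: c6; rewrite mulf_eq0 (negPf f30) /= => /eqP g30.
  move/eqP: g30 (g30); rewrite {1}/g3 mulf_eq0 (negPf f30) orbF => /eqP al0 g30.
  move/eqP: c5; rewrite g30 mulr0 add0r mulf_eq0 (negPf f30) /g2 al0.
  rewrite mul0r add0r.
  by rewrite oppr_eq0 mulf_eq0 (negPf q0) (negPf r20).
have [] := polar_line01 isoD l1 r20; rewrite m1 -/s2 -/h2 => al0 s20 h20.
have r10 : r1 = 0.
  move/eqP: c3; rewrite /g0 /g1 /g2 /g3 /f0 /f1 /f2 /f3 r20 s20 al0.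
  rewrite (_ : _ + _ = q * (r1 * r1)); last by ring.
  by rewrite !mulf_eq0 (negPf q0) /= orbb => /eqP.
move/eqP: c2; rewrite /g0 /g1 /g2 /f0 /f1 /f2 r20 s20 al0 r10.
rewrite (_ : _ + _ = q ^+ 2 * h2); last by ring.
by rewrite mulf_eq0 expf_eq0 (negPf q0) (negPf h20).
Qed.

(** As polar2 = 0, the linear part is scalar, and it is 0 by [polar_line] at a
    zero of polar3.  Any zero of polar3 is a common zero of P2 and Q2 for the
    same reason.  If polar3 has two independent zeros, put at (1 : 0) and
    (0 : 1), then P2 = r xy and Q2 = s xy, and the third zero (r : s) gives
    rs = 0; if r = s = 0, a zero of h contradicts [polar_line].  Otherwise
    polar3 has a triple zero at (0 : 1), so that polar3(1, m) is constant. *)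
Lemma no_linear_part_normal D : (2 : K) != 0 -> isolated D ->
  (forall x y, polar2 D x y = 0) -> exists2 i, (i < 4)%N & reduces_to D i.
Proof.
move=> n2 isoD phi2.
have [a [b [c [d [det0 root01 root10]]]]] :=
  binary_form_basis (polar3_Poly D) (i := 2%N) (polar3_01 D).
have [D' [isoD' conjD _ phi2' phi3']] := germ_linear_change det0 isoD.
suff [i lti red] : exists2 i, (i < 4)%N & reduces_to D' i.
  exists i => //; apply: conjugate_values_trans red.
  exact: conjugate_values_sym.
have {root01} root01 : polar3 D' 0 1 = 0.
  by rewrite phi3' !mulr0 !mulr1 !add0r.
have {root10} root10 : polar3 D' 1 0 = 0 \/ forall m, polar3 D' 1 m != 0.
  case: root10 => [e|e]; [left|right=> m].
    by rewrite phi3' !mulr0 !mulr1 !addr0.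
  by rewrite phi3' !mulr1.
have {}phi2 x y : polar2 D' x y = 0 by rewrite phi2' phi2.
move: D' isoD' phi2 root01 root10 {phi2' phi3' conjD} => {det0 isoD a b c d}.
move=> {}D isoD phi2; rewrite polar3_01 polar3_10 => /eqP.
rewrite oppr_eq0 => /eqP r2 root10.
have l1 : gP1 D 1%N = 0 by apply/eqP; rewrite -oppr_eq0 -polar2_01 phi2.
have m0 : gQ1 D 0%N = 0 by rewrite -polar2_10 phi2.
have [m1 s2 h2] := polar_line01 isoD l1 r2.
have l0 : gP1 D 0%N = 0.
  have := phi2 1 1; rewrite /polar2 /lin l1 m0 m1.
  rewrite !(mul1r, mulr1, mul0r, add0r, addr0) => /eqP.
  by rewrite oppr_eq0 => /eqP.
case: root10 => [s0|noroot].
  have [_ r0 h0] := polar_line10 isoD m0 s0.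
  have phi3E x y : polar3 D x y = x * y * (x * gQ2 D 1%N - y * gP2 D 1%N).
    by rewrite /polar3 /quad r0 r2 s0 s2; ring.
  have [s1|s1] := eqVneq (gQ2 D 1%N) 0; have [r1|r1] := eqVneq (gP2 D 1%N) 0.
  - have hPoly m : quad (gh D) 1 m =
        (Poly [:: gh D 0%N; gh D 1%N; gh D 2%N]).[m].
      by rewrite horner_Poly /quad /=; ring.
    have [a [b [c [d [det0 hbd _]]]]] :=
      binary_form_basis hPoly (i := 1%N) (quad01 (gh D)).
    have bd0 : (b != 0) || (d != 0).
      apply: contraNT det0; rewrite negb_or !negbK => /andP[/eqP-> /eqP->].
      by rewrite mulr0 mul0r subrr.
    have [||_ _ _ _] := polar_line isoD bd0; rewrite ?phi2 //.
      by rewrite phi3E s1 r1 !mulr0 subrr mulr0.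
    by rewrite hbd eqxx.
  - by exists 2%N => //; apply: reduces_to_normal3_swap.
  - by exists 2%N => //; apply: reduces_to_normal3.
  have xy0 : (gP2 D 1%N != 0) || (gQ2 D 1%N != 0) by rewrite r1.
  have [|_ _ + _ _] := polar_line isoD xy0 (phi2 _ _).
    by rewrite phi3E; ring.
  rewrite /quad r0 r2 => /eqP.
  by rewrite mul0r add0r mul0r addr0 !mulf_eq0 (negPf s1) (negPf r1).
have {}noroot m : (Poly [:: gQ2 D 0%N; gQ2 D 1%N - gP2 D 0%N;
    gQ2 D 2%N - gP2 D 1%N; - gP2 D 2%N]).[m] != 0 by rewrite -polar3_Poly.
have /eqP := Poly_rootless noroot 0%N; rewrite /= subr_eq0 => /eqP s1.
have /eqP := Poly_rootless noroot 1%N; rewrite /= s2 sub0r oppr_eq0 => /eqP r1.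
have s0 : gQ2 D 0%N != 0.
  by have := noroot 0; rewrite horner_Poly /= mulr0 add0r.
have [r0|r0] := eqVneq (gP2 D 0%N) 0.
  by exists 0%N => //; apply: reduces_to_normal1; rewrite // s1.
by exists 1%N => //; apply: reduces_to_normal2.
Qed.

(** A diagonal linear part (al x, be y) with al nonzero and different from be.
    The coefficient of m^6 in R(1, m), which has no zero, is
    be r2^2 with r2 the coefficient of y^2 in P2, and r2 = 0 also gives be = 0:
    so the germ is a saddle-node.  The other coefficients solve for P2 and h in
    terms of Q2. *)
Lemma saddle_node_normal D : isolated D -> gP1 D 1%N = 0 -> gQ1 D 0%N = 0 ->
  gP1 D 0%N != 0 -> gP1 D 0%N != gQ1 D 1%N -> reduces_to D 3.
Proof.
move=> isoD l1 m0 l0 neq.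
have q0 : gQ2 D 0%N != 0.
  apply/eqP => q0; have [e _ _] := polar_line10 isoD m0 q0.
  by rewrite e eqxx in l0.
set al := gP1 D 0%N in l0 neq; set be := gQ1 D 1%N in neq.
pose r0 := gP2 D 0%N; pose r1 := gP2 D 1%N; pose r2 := gP2 D 2%N.
pose s0 := gQ2 D 0%N; pose s1 := gQ2 D 1%N; pose s2 := gQ2 D 2%N.
pose h0 := gh D 0%N; pose h1 := gh D 1%N; pose h2 := gh D 2%N.
rewrite -/s0 in q0.
(* At m = 0 polar2 vanishes, but R does not. *)
have Resm m : polar_res D 1 m != 0.
  have [->|mn0] := eqVneq m 0.
    rewrite (_ : polar_res D 1 0 = al * s0 ^+ 2) ?mulf_neq0 ?expf_neq0 //.
    by rewrite /polar_res /polar2 /polar3 /lin /quad m0 -/al -/s0; ring.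
  apply: polar_res_neq0 => //; rewrite (_ : polar2 _ _ _ = (be - al) * m).
    by rewrite mulf_neq0 // subr_eq0 eq_sym.
  by rewrite /polar2 /lin m0 l1 -/al -/be; ring.
(* f and g list the coefficients in m of polar3 and P1 Q2 - Q1 P2 at (1, m). *)
pose f0 := s0; pose f1 := s1 - r0; pose f2 := s2 - r1; pose f3 := - r2.
pose g0 := al * s0; pose g1 := al * s1 - be * r0.
pose g2 := al * s2 - be * r1; pose g3 := - (be * r2).
pose c := (be - al) ^+ 2.
have PolyR m : (Poly [:: f0 * g0; f0 * g1 + f1 * g0;
    f0 * g2 + f1 * g1 + f2 * g0 + c * h0;
    f0 * g3 + f1 * g2 + f2 * g1 + f3 * g0 + c * h1;
    f1 * g3 + f2 * g2 + f3 * g1 + c * h2;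
    f2 * g3 + f3 * g2; f3 * g3]).[m] != 0.
  rewrite (_ : _.[m] = polar_res D 1 m) // horner_Poly /=.
  rewrite /polar_res /polar2 /polar3 /lin /quad l1 m0 -/be -/al.
  rewrite /c /g0 /g1 /g2 /g3 /f0 /f1 /f2 /f3.
  by rewrite /r0 /r1 /r2 /s0 /s1 /s2 /h0 /h1 /h2; ring.
have := Poly_rootless PolyR 5%N; rewrite /= /f3 /g3 mulrNN mulrCA.
move=> /eqP; rewrite !mulf_eq0 orbb => be_r2.
have be0 : be = 0.
  case/orP: be_r2 => /eqP // r20.
  by have [] := polar_line01 isoD l1 r20.
have e1 : f0 * g1 + f1 * g0 = 0 := Poly_rootless PolyR 0%N.
have e2 : f0 * g2 + f1 * g1 + f2 * g0 + c * h0 = 0 := Poly_rootless PolyR 1%N.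
have e3 : f0 * g3 + f1 * g2 + f2 * g1 + f3 * g0 + c * h1 = 0 :=
  Poly_rootless PolyR 2%N.
have e4 : f1 * g3 + f2 * g2 + f3 * g1 + c * h2 = 0 := Poly_rootless PolyR 3%N.
have e5 : f2 * g3 + f3 * g2 = 0 := Poly_rootless PolyR 4%N.
have simp := (be0, mul0r, subr0, sub0r, oppr0, sqrrN).
rewrite /g0 /g1 /g2 /g3 /c !simp in e1 e2 e3 e4 e5.
have al_inj u v : al * (u - v) = 0 -> u = v.
  by move=> /eqP; rewrite mulf_eq0 (negPf l0) subr_eq0 => /eqP.
have r0E : r0 = 2 * s1.
  apply: al_inj; apply: (mulfI q0); rewrite mulr0 -[RHS]oppr0 -[in RHS]e1.
  by rewrite /f0 /f1; ring.
have [r2n0 s20] : r2 != 0 /\ s2 = 0.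
  have [r20|r2n0] := eqVneq r2 0.
    have [_ s20 h20] := polar_line01 isoD l1 r20; exfalso.
    rewrite -/s2 in s20; rewrite -/h2 in h20.
    move/eqP: e4; rewrite /f3 r20 s20 !(mulr0, oppr0, mul0r, add0r).
    by rewrite mulf_eq0 expf_eq0 (negPf l0) (negPf h20).
  split=> //; move/eqP: e5; rewrite /f3 mulr0 add0r !mulf_eq0 oppr_eq0.
  by rewrite (negPf r2n0) (negPf l0) => /eqP.
apply: reduces_to_normal4; split=> //.
- apply: al_inj; rewrite -[RHS]e2 /f0 /f1 /f2 -/al -/h0 -/s0 -/s1 -/r1.
  by rewrite r0E s20; ring.
- apply: al_inj; rewrite -[RHS]e3 /f0 /f1 /f2 /f3 -/al -/h1 -/s0 -/s1 -/r1.
  by rewrite -/r2 r0E s20; ring.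
- apply: al_inj; rewrite -[RHS]e4 /f1 /f2 /f3 -/al -/h2 -/s1 -/r2.
  by rewrite s20; ring.
Qed.

(** When the eigenvalue on the x axis vanishes and the other one does not,
    exchanging x and y leads to [saddle_node_normal]. *)
Lemma isolated_germ_normal D : (2 : K) != 0 -> isolated D ->
  exists2 i, (i < 4)%N & reduces_to D i.
Proof.
move=> n2 isoD.
have [a [b [c [d [det0 root01 root10]]]]] :=
  binary_form_basis (polar2_Poly D) (i := 1%N) (polar2_01 D).
have [D' [isoD' conjD _ phi2' _]] := germ_linear_change det0 isoD.
suff [i lti red] : exists2 i, (i < 4)%N & reduces_to D' i.
  exists i => //; apply: conjugate_values_trans red.
  exact: conjugate_values_sym.
have {root01} root01 : polar2 D' 0 1 = 0.
  by rewrite phi2' !mulr0 !mulr1 !add0r.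
have {root10} root10 : polar2 D' 1 0 = 0.
  case: root10 => [e|e]; first by rewrite phi2' !mulr0 !mulr1 !addr0.
  case: (single_tangent_absurd isoD' root01) => m.
  by rewrite phi2' !mulr1.
move: D' isoD' root01 root10 {phi2' conjD} => {det0 isoD a b c d}.
move=> {}D isoD phi01 phi10.
have m0 : gQ1 D 0%N = 0 by rewrite -polar2_10.
have l1 : gP1 D 1%N = 0 by apply/eqP; rewrite -oppr_eq0 -polar2_01 phi01.
have phi2E x y : polar2 D x y = (gQ1 D 1%N - gP1 D 0%N) * (x * y).
  by rewrite /polar2 /lin l1 m0; ring.
have [e|neq] := eqVneq (gP1 D 0%N) (gQ1 D 1%N).
  by apply: no_linear_part_normal => // x y; rewrite phi2E e subrr mul0r.
exists 3%N => //; have [l0|l0] := eqVneq (gP1 D 0%N) 0;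
  last exact: saddle_node_normal.
(* The linear part is (0, be y): exchange x and y. *)
have det0 : 0 * 0 - 1 * 1 != 0 :> K.
  by rewrite mul0r mul1r sub0r oppr_eq0 oner_neq0.
have [D' [isoD' conjD P1' phi2' _]] := germ_linear_change det0 isoD.
apply: (conjugate_values_trans (f2 := germ_values D')).
  exact: conjugate_values_sym.
have l0' : gP1 D' 0%N = - gQ1 D 1%N.
  by rewrite -lin10 P1' /lin l1 l0 m0; ring.
have phiD x y : polar2 D' x y = gQ1 D 1%N * (x * y).
  by rewrite phi2' phi2E l0; ring.
have l1' : gP1 D' 1%N = 0.
  by apply/eqP; rewrite -oppr_eq0 -polar2_01 phiD mul0r mulr0.
have m0' : gQ1 D' 0%N = 0 by rewrite -polar2_10 phiD !mulr0.
have n0 : gQ1 D 1%N != 0 by rewrite -l0 eq_sym.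
apply: saddle_node_normal => //; first by rewrite l0' oppr_eq0.
apply: contraNneq n0 => e.
have := phiD 1 1; rewrite /polar2 /lin l1' m0' e.
rewrite !(mulr1, mul1r, mul0r, add0r, addr0).
by rewrite subrr => <-.
Qed.

(** * The four normal forms *)

Lemma normal_germ_isolated i : isolated (normal_germ i).
Proof.
have cube0 u : - u ^+ 3 = 0 :> K -> u = 0.
  by move/eqP; rewrite oppr_eq0 expf_eq0 => /eqP.
move=> v /rowP e; move: (e 0) (e 1) (e 2%R); rewrite !mxE.
move: (v 0 0) (v 1 0) (v 2%R 0) => x y z {v e}.
case: i => [|[|[|i]]] /=; rewrite /polar2 /polar3 /lin /quad /= => ea eb ec.
- have x0 : x = 0 by apply: cube0; rewrite -[RHS]ec; ring.
  by split=> //; apply: cube0; rewrite -[RHS]ea x0; ring.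
- have x0 : x = 0 by apply: cube0; rewrite -[RHS]ec; ring.
  by split=> //; apply: cube0; rewrite -[RHS]ea x0; ring.
- have /eqP : x ^+ 2 * y = 0 by rewrite -[RHS]oppr0 -[in RHS]ec; ring.
  rewrite mulf_eq0 expf_eq0 /= => /orP[] /eqP t0; split=> //; apply: cube0.
    by rewrite -[RHS]ea t0; ring.
  by rewrite -[RHS]oppr0 -[in RHS]eb t0; ring.
- have x0 : x = 0.
    apply/eqP/negPn/negP => x0.
    have xz : x * z = - y ^+ 2.
      apply: (mulfI x0); apply/eqP; rewrite -subr_eq0; apply/eqP.
      by rewrite -[RHS]ea; ring.
    have y0 : y = 0.
      apply: (mulfI x0); apply: (mulfI x0).
      rewrite !mulr0 -[RHS]oppr0 -[in RHS]eb.
      transitivity (- (x * z * z + y ^+ 2 * z - x * (x * y))); last by ring.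
      by rewrite xz; ring.
    have z0 : z = 0.
      by apply: (mulfI x0); rewrite xz y0 expr0n oppr0 mulr0.
    by move/eqP: x0; apply; apply: cube0; rewrite -[RHS]ec y0 z0; ring.
  by split=> //; apply: cube0; rewrite -[RHS]ec x0; ring.
Qed.

Lemma germ_values_vertex D : germ_values D (vec3 0 0 1) = 0.
Proof.
by apply/rowP; apply: ord3P; rewrite !mxE /= /polar2 /polar3 /lin /quad; ring.
Qed.

(** Points are rows in the definition, columns here. *)
Lemma singular_valuesP (w : poly_form K 3) (p : 'rV[K]_3) :
  singular_point w p <-> p != 0 /\ values w p^T = 0.
Proof.
have evE i : values w p^T 0 i = (w 0 i).@[p 0].
  by rewrite mxE; apply: meval_eq => j; rewrite mxE.
split=> -[p0 e]; split=> //; first by apply/rowP => i; rewrite evE e mxE.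
by move=> i; rewrite -evE e mxE.
Qed.

Lemma germ_form_good D : isolated D ->
  is_foliation 2 (germ_form D) /\ has_unique_singular_point (germ_form D).
Proof.
move=> isoD; have [hom rel] := germ_form_foliation D; split.
  split=> //; apply: no_common_factor_of_zeros => v v0.
  have /isoD : germ_values D (\col_j v j) = 0.
    rewrite -values_germ_form; apply/rowP => i.
    rewrite [LHS]mxE [RHS]mxE -[RHS](v0 i).
    by apply: meval_eq => j; rewrite mxE.
  by rewrite !mxE.
exists (vec3 0 0 1)^T.
  apply/singular_valuesP; rewrite trmxK values_germ_form germ_values_vertex.
  split=> //; apply/eqP => /rowP/(_ 2%R); rewrite !mxE /= => /eqP.
  by rewrite oner_eq0.
move=> q /singular_valuesP[q0]; rewrite values_germ_form => /isoD[].
rewrite !mxE => q00 q01.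
have qE : q = q 0 2%R *: (vec3 0 0 1)^T.
  by apply/rowP; apply: ord3P; rewrite !mxE /= ?mulr0 ?mulr1.
by exists (q 0 2%R) => //; apply: contraNneq q0 => q02; rewrite qE q02 scale0r.
Qed.

(** A conjugacy maps the singular point to the singular point, so its matrix is
    block triangular: a converse to [conjugate_by_block]. *)
Lemma conjugate_block (f f' : 'cV[K]_3 -> 'rV[K]_3) :
  f (vec3 0 0 1) = 0 -> (forall v, f' v = 0 -> v 0 0 = 0 /\ v 1 0 = 0) ->
  conjugate_values f f' ->
  exists a b c d r s t k, [/\ t != 0, k != 0 & forall x y z,
    let w :=
      f' (vec3 (a * x + b * y) (c * x + d * y) (r * x + s * y + t * z)) in
    [/\ w 0 0 * a + w 0 1 * c + w 0 2%R * r = k * f (vec3 x y z) 0 0,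
        w 0 0 * b + w 0 1 * d + w 0 2%R * s = k * f (vec3 x y z) 0 1
      & w 0 2%R * t = k * f (vec3 x y z) 0 2%R]].
Proof.
move=> f0 isof' [A uA [k k0 e]].
have AE x y z : A *m vec3 x y z =
    vec3 (A 0 0 * x + A 0 1 * y + A 0 2%R * z)
         (A 1 0 * x + A 1 1 * y + A 1 2%R * z)
         (A 2%R 0 * x + A 2%R 1 * y + A 2%R 2%R * z).
  by apply/colP; apply: ord3P; rewrite mxE sum3 !mxE.
have /isof' : f' (A *m vec3 0 0 1) = 0.
  by rewrite -[LHS](mulmxK uA) e f0 scaler0 mul0mx.
rewrite AE !mxE /= !(mulr0, add0r, mulr1) => -[A02 A12].
exists (A 0 0), (A 0 1), (A 1 0), (A 1 1), (A 2%R 0), (A 2%R 1), (A 2%R 2%R), k.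
split=> //.
  apply/eqP => A22; have : invmx A *m (A *m vec3 0 0 1) = 0.
    rewrite AE A02 A12 A22 !(mulr0, mul0r, addr0).
    rewrite (_ : vec3 0 0 0 = 0) ?mulmx0 //.
    by apply/colP; apply: ord3P; rewrite !mxE.
  rewrite mulKmx // => /colP/(_ 2%R); rewrite !mxE /= => /eqP.
  by rewrite oner_eq0.
move=> x y z; have {}e := e (vec3 x y z).
rewrite AE A02 A12 !mul0r !addr0 in e.
split; [move/rowP/(_ 0): e|move/rowP/(_ 1): e|move/rowP/(_ 2%R): e];
  rewrite [X in X = _]mxE sum3 [X in _ = X]mxE => <- //.
by rewrite A02 A12 !mulr0 !add0r.
Qed.

Lemma normal_germ_dZ i x y z :
  germ_values (normal_germ i) (vec3 x y z) 0 2%R =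
    match i with
    | 0 | 1 => - x ^+ 3
    | 2 => - (x ^+ 2 * y)
    | _ => - (x ^+ 3 + x * y * z + y ^+ 3)
    end.
Proof.
by case: i => [|[|[|i]]]; rewrite !mxE /= /polar2 /polar3 /lin /quad /=; ring.
Qed.

Lemma normal_germ_dY i x y z : (i < 2)%N ->
  germ_values (normal_germ i) (vec3 x y z) 0 1 = x * (i%:R * (x * z) + y ^+ 2).
Proof. by case: i => [|[|//]] _; rewrite !mxE /= /lin /quad /=; ring. Qed.

(** The coefficients of dZ correspond up to a constant.  The last one depends on
    z and the others do not; X^3 becomes the cube of a linear form, unlike
    x^2 y.  Between the second and the first form the conjugacy preserves the
    line x = 0, and the coefficient of dY depends on z only for the second. *)
Lemma normal_germs_not_conjugate i j : (j < i)%N -> (i < 4)%N ->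
  ~ conjugate_values (germ_values (normal_germ i))
                     (germ_values (normal_germ j)).
Proof.
move=> ji i4.
move=> /(conjugate_block (germ_values_vertex _) (@normal_germ_isolated j)).
move=> [a [b [c [d [r [s [t [k [t0 /eqP k0 e]]]]]]]]].
have eY x y z := let: And3 _ e1 _ := e x y z in e1.
have eZ x y z := let: And3 _ _ e2 := e x y z in e2.
have cube0 u : - u ^+ 3 * t = 0 -> u = 0.
  by move/eqP; rewrite mulf_eq0 (negPf t0) orbF oppr_eq0 expf_eq0 => /eqP.
have cube_absurd :
    ~ forall x y, - (a * x + b * y) ^+ 3 * t = k * - (x ^+ 2 * y).
  move=> e3; have a0 : a = 0.
    by apply: cube0; move: (e3 1 0); rewrite !(mulr1, mulr0, addr0, oppr0).
  have b0 : b = 0.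
    apply: cube0; move: (e3 0 1).
    by rewrite expr0n !(mulr1, mulr0, add0r, mul0r, oppr0).
  apply: k0; move: (e3 1 1); rewrite a0 b0 => e11.
  transitivity (- (k * - (1 ^+ 2 * 1))); first by ring.
  by rewrite -e11; ring.
move: i j i4 ji eY eZ {e} => [|[|[|[|//]]]] [|[|[|//]]] // _ _ eY eZ.
- have b0 : b = 0.
    apply: cube0; move: (eZ 0 1 0); rewrite !normal_germ_dZ => e01.
    by transitivity (- (a * 0 + b * 1) ^+ 3 * t); [|rewrite e01]; ring.
  apply: k0; have e11 := eY 1 0 1; have e10 := eY 1 0 0.
  move: e11 e10; rewrite !normal_germ_dY // !normal_germ_dZ b0 => e11 e10.
  transitivity (k * (1 * (1 * (1 * 1) + 0 ^+ 2))
                - k * (1 * (1 * (1 * 0) + 0 ^+ 2))).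
    by ring.
  by rewrite -e11 -e10; ring.
- by apply: cube_absurd => x y; move: (eZ x y 0); rewrite !normal_germ_dZ.
- by apply: cube_absurd => x y; move: (eZ x y 0); rewrite !normal_germ_dZ.
all: apply: k0; move: (eZ 1 1 0) (eZ 1 1 1); rewrite !normal_germ_dZ => e0 e1.
all: transitivity (k * - (1 ^+ 3 + 1 * 1 * 0 + 1 ^+ 3)
                   - k * - (1 ^+ 3 + 1 * 1 * 1 + 1 ^+ 3)); first by ring.
all: by rewrite -e0 -e1; ring.
Qed.

(** * From germs back to foliations *)

Lemma pullback_homog (A : 'M[K]_3) (w : poly_form K 3) n :
  (forall i, w 0 i \is n.-homog) ->
  forall i, form_pullback (linear_subst A) w 0 i \is n.-homog.
Proof.
move=> hw j; rewrite form_pullback_linearE rpred_sum // => i _.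
rewrite mulrC mul_mpolyC dhomogZ // comp_mpolyE big_seq rpred_sum // => m mw.
rewrite dhomogZ // -(dhomog_mf (hw i) mw) /= mdegE.
elim/big_rec2: _ => [|l d p _ hp]; first exact: dhomog1.
apply: dhomogM => //; rewrite -[X in X.-homog]mul1n; apply: dhomogMn.
rewrite tnth_mktuple rpred_sum // => s _.
by rewrite dhomogZ // dhomogX /= mdeg1.
Qed.

(** Complete p to a basis by two unit vectors, chosen according to a nonzero
    coordinate. *)
Lemma vertex_to (p : 'cV[K]_3) : p != 0 ->
  exists2 A : 'M[K]_3, A \in unitmx & A *m vec3 0 0 1 = p.
Proof.
move=> p0.
have unit_of (A B : 'M[K]_3) : A *m B = 1%:M -> A \in unitmx.
  by move=> /mulmx1_unit[].
set x := p 0 0; set y := p 1 0; set z := p 2%R 0.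
have pE : p = vec3 x y z by exact: vec3E.
have [z0|z0] := eqVneq z 0; last first.
  exists (mx3 1 0 x 0 1 y 0 0 z).
    apply: (unit_of _ (mx3 1 0 (- x / z) 0 1 (- y / z) 0 0 z^-1)).
    apply/matrixP; apply: ord3P; apply: ord3P; rewrite mxE sum3 !mxE /=;
      by field.
  by rewrite mx3_vec3 [RHS]pE; congr vec3; ring.
have [y0|y0] := eqVneq y 0; last first.
  exists (mx3 1 0 x 0 0 y 0 1 z).
    apply: (unit_of _ (mx3 1 (- x / y) 0 0 (- z / y) 1 0 y^-1 0)).
    apply/matrixP; apply: ord3P; apply: ord3P; rewrite mxE sum3 !mxE /=;
      by field.
  by rewrite mx3_vec3 [RHS]pE; congr vec3; ring.
have x0 : x != 0.
  apply: contraNneq p0 => x0; rewrite pE x0 y0 z0.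
  by apply/eqP/colP; apply: ord3P; rewrite !mxE.
exists (mx3 0 0 x 1 0 y 0 1 z).
  apply: (unit_of _ (mx3 (- y / x) 1 0 (- z / x) 0 1 x^-1 0 0)).
  by apply/matrixP; apply: ord3P; apply: ord3P; rewrite mxE sum3 !mxE /=; field.
by rewrite mx3_vec3 [RHS]pE; congr vec3; ring.
Qed.

Lemma foliation_normal (w : poly_form K 3) : (2 : K) != 0 ->
  is_foliation 2 w -> has_unique_singular_point w ->
  exists2 i, (i < 4)%N & conjugate_foliations w (germ_form (normal_germ i)).
Proof.
move=> n2 [hw _ rel] [p /singular_valuesP[p0 wp] uniq_p].
have [A uA Ap] : exists2 A : 'M[K]_3, A \in unitmx & A *m vec3 0 0 1 = p^T.
  by apply: vertex_to; rewrite -(inj_eq trmx_inj) trmxK linear0.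
set w1 := form_pullback (linear_subst A) w.
have contr v : values w v *m v = 0.
  apply/matrixP => i j; rewrite !ord1 mxE [RHS]mxE.
  transitivity ((\sum_i w 0 i * 'X_i).@[fun j => v j 0]); last first.
    by rewrite rel meval0.
  by rewrite raddf_sum; apply: eq_bigr => l _ /=; rewrite mevalM mevalXU mxE.
have [D wD] : exists D, values w1 =1 germ_values D.
  apply: germ_of_foliation; first exact: pullback_homog.
  - by move=> v; rewrite values_pullback -mulmxA contr.
  - by rewrite values_pullback Ap wp mul0mx.
have isoD : isolated D.
  move=> v; rewrite -wD values_pullback => e.
  have {}e : values w (A *m v) = 0 by rewrite -[LHS](mulmxK uA) e mul0mx.
  have [k vE] : exists k, v = k *: vec3 0 0 1.
    have [Av0|Av0] := eqVneq (A *m v) 0.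
      by exists 0; rewrite scale0r -[LHS](mulKmx uA) Av0 mulmx0.
    have [|k _ /(congr1 trmx)] := uniq_p (A *m v)^T.
      apply/singular_valuesP; rewrite trmxK e; split=> //.
      by rewrite -(inj_eq trmx_inj) trmxK linear0.
    rewrite trmxK linearZ /= -Ap => Av; exists k.
    by rewrite -[LHS](mulKmx uA) Av -scalemxAr mulKmx.
  by rewrite vE !mxE /= mulr0.
have [i lti red] := isolated_germ_normal n2 isoD.
exists i => //; apply/conjugate_valuesP.
apply: (conjugate_values_trans (f2 := values w1)).
  exact/conjugate_values_sym/conjugate_values_pullback.
case: red => B uB [k k0 e]; exists B => //; exists k => // v.
by rewrite values_germ_form e wD.
Qed.

Lemma affine_restriction_germ D :
  let x : {mpoly K[2]} := 'X_0 in
  let y : {mpoly K[2]} := 'X_1 in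
  let C (e : nat -> K) n := (e n)%:MP in
  let P := lin (C (gP1 D)) x y + quad (C (gP2 D)) x y
           + x * quad (C (gh D)) x y in
  let Q := lin (C (gQ1 D)) x y + quad (C (gQ2 D)) x y
           + y * quad (C (gh D)) x y in
  affine_restriction (germ_form D)
    = P *: poly_differential y - Q *: poly_differential x.
Proof.
move=> x y C P Q; rewrite /affine_restriction /form_pullback.
set phi := [tuple x; y; 1].
have phi0 : 'X_0 \mPo phi = x by rewrite comp_mpolyXU.
have phi1 : 'X_1 \mPo phi = y by rewrite comp_mpolyXU.
have phi2 : 'X_2 \mPo phi = 1 by rewrite comp_mpolyXU.
have phiM p q : (p * q) \mPo phi = (p \mPo phi) * (q \mPo phi).
  exact: rmorphM.
have linE l : lin (fun n => (l n)%:MP) 'X_0 'X_1 \mPo phi = lin (C l) x y.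
  by rewrite /lin comp_mpolyD !phiM !comp_mpolyC phi0 phi1.
have quadE l : quad (fun n => (l n)%:MP) 'X_0 'X_1 \mPo phi = quad (C l) x y.
  by rewrite /quad !comp_mpolyD !phiM !comp_mpolyC phi0 phi1.
have d1 : poly_differential 1 = 0 :> poly_form K 2.
  by apply/rowP => j; rewrite !mxE -mpolyC1 mderivC.
rewrite sum3 !(tnth_nth 0) /= d1 scaler0 addr0 !mxE /=.
rewrite comp_mpolyN !comp_mpolyD !phiM !linE !quadE phi0 phi1 phi2 !mulr1.
by rewrite scaleNr addrC.
Qed.

Lemma affine_normal_forms (i : 'I_4) :
  affine_restriction (germ_form (normal_germ i))
    = tnth [tuple omega1 K; omega2 K; omega3 K; omega4 K] i.
Proof.
rewrite affine_restriction_germ (tnth_nth 0).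
case: i => [[|[|[|[|//]]]] lti] /=.
all: rewrite /omega1 /omega2 /omega3 /omega4 /lin /quad /=.
all: rewrite !(mpolyC0, mpolyC1, mpolyCN).
all: by apply/rowP => j; rewrite !mxE; ring.
Qed.

Lemma conjugate_germ_formsP D D' :
  conjugate_foliations (germ_form D) (germ_form D') <->
  conjugate_values (germ_values D) (germ_values D').
Proof.
split=> [/conjugate_valuesP|] [A uA [k k0 e]].
  by exists A => //; exists k => // v; rewrite -!values_germ_form e.
by apply/conjugate_valuesP; exists A => //; exists k => // v;
  rewrite !values_germ_form e.
Qed.

Lemma normal_forms_not_conjugate (i j : 'I_4) : i != j ->
  ~ conjugate_foliations (germ_form (normal_germ i))
                         (germ_form (normal_germ j)).
Proof.
rewrite -val_eqE neq_ltn => /orP[lt|lt] /conjugate_germ_formsP c.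
  exact: normal_germs_not_conjugate lt (ltn_ord _) (conjugate_values_sym c).
exact: normal_germs_not_conjugate lt (ltn_ord _) c.
Qed.

End Classification.

Theorem mainTheorem1 (R : realType) :
  exists F : 'I_4 -> poly_form R[i] 3,
    [/\ forall i, is_foliation 2 (F i) /\ has_unique_singular_point (F i),
        forall i, affine_restriction (F i)
          = tnth [tuple omega1 R[i]; omega2 R[i]; omega3 R[i]; omega4 R[i]] i,
        forall i j, i != j -> ~ conjugate_foliations (F i) (F j)
      & forall G : poly_form R[i] 3,
          is_foliation 2 G -> has_unique_singular_point G ->
          exists i, conjugate_foliations G (F i)].
Proof.
exists (fun i => germ_form (normal_germ R[i] i)); split.
- by move=> i; apply: germ_form_good; exact: normal_germ_isolated.
- exact: affine_normal_forms.
- exact: normal_forms_not_conjugate.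
- move=> G hG uG; have n2 : (2 : R[i]) != 0 by rewrite Num.Theory.pnatr_eq0.
  have [i lti c] := foliation_normal n2 hG uG.
  by exists (Ordinal lti).
Qed.
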